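(* Let $\mathcal{X}=(\Omega,S)$ be a quasitrivial coherent configuration with set of fibers $\Phi$. Define a relation $\sim$ on $\Phi$ by $\Delta\sim\Lambda$ iff $\Delta=\Lambda$ or $|S_{\Delta,\Lambda}|=2$; this is an equivalence relation. Let $\Phi_1,\dots,\Phi_m$ be its classes, and write $\Phi_i=\{\Delta_{i1},\dots,\Delta_{im_i}\}$. For each $i$ and each $j$ with $1<j\le m_i$, let $f_{ij}:\Delta_{i1}\to\Delta_{ij}$ be a bijection whose graph belongs to $S_{\Delta_{i1},\Delta_{ij}}$ (such a bijection exists). Then $$\mathrm{Aut}(\mathcal{X})\cong\prod_{i=1}^m\mathrm{Sym}(\Delta_{i1}).$$ Moreover, a permutation $g$ of $\Omega$ belongs to $\mathrm{Aut}(\mathcal{X})$ if and only if $g$ leaves every fiber invariant and for every $i=1,\dots,m$ there exists $g_i\in\mathrm{Sym}(\Delta_{i1})$ such that $g^{\Delta_{i1}}=g_i$ and $g^{\Delta_{ij}}=f_{ij}^{-1}g_if_{ij}$ for $1<j\le m_i$ (permutations and maps are composed left to right, acting on the right).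
   Context: Let $\Omega$ be a finite set. For $r\subseteq\Omega\times\Omega$ and $\alpha\in\Omega$ put $\alpha r=\{\beta:(\alpha,\beta)\in r\}$ and $r^*=\{(\beta,\alpha):(\alpha,\beta)\in r\}$. A coherent configuration on $\Omega$ is a pair $\mathcal{X}=(\Omega,S)$, where $S$ is a partition of $\Omega\times\Omega$ such that the diagonal $1_\Omega$ is a union of elements of $S$, $s^*\in S$ for all $s\in S$, and for all $r,s,t\in S$ the number $|\alpha r\cap\beta s^*|$ does not depend on the choice of $(\alpha,\beta)\in t$. A fiber is a set $\Delta\subseteq\Omega$ with $1_\Delta\in S$. For fibers $\Delta,\Lambda$, $S_{\Delta,\Lambda}=\{s\in S:s\subseteq\Delta\times\Lambda\}$. $\mathrm{Aut}(\mathcal{X})$ is the group of permutations $f$ of $\Omega$ with $s^f=s$ for all $s\in S$; for a fiber $\Delta$ (which is $\mathrm{Aut}(\mathcal{X})$-invariant), $g^\Delta$ denotes the restriction of $g$ to $\Delta$ and $\mathrm{Aut}(\mathcal{X})^\Delta$ the induced group. $\mathcal{X}$ is quasitrivial if $\mathrm{Aut}(\mathcal{X})^\Delta=\mathrm{Sym}(\Delta)$ for every fiber $\Delta$. *)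

(* Defs.v *)
From mathcomp Require Import all_boot all_fingroup.

Set Implicit Arguments.
Unset Strict Implicit.
Unset Printing Implicit Defensive.

Import GroupScope.

Section CoherentConfigurations.

Variable T : finType.

Implicit Types (r : {set T * T}) (S : {set {set T * T}}) (D L : {set T}).

Definition neighbors (a : T) r : {set T} := [set b | (a, b) \in r].

Definition converse r : {set T * T} := [set p | (p.2, p.1) \in r].

Definition diag D : {set T * T} := [set (x, x) | x in D].

Definition coherent S : Prop :=
  [/\ partition S [set: T * T],
      exists2 E : {set {set T * T}}, E \subset S & cover E = diag [set: T],
      {in S, forall s, converse s \in S}
    & forall r s t : {set T * T}, r \in S -> s \in S -> t \in S ->
      forall a b a' b' : T, (a, b) \in t -> (a', b') \in t ->
      #|neighbors a r :&: neighbors b (converse s)| =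
      #|neighbors a' r :&: neighbors b' (converse s)|].

Definition fibers S : {set {set T}} := [set D | diag D \in S].

Definition rels_between S D L : {set {set T * T}} :=
  [set s in S | s \subset setX D L].

Definition rel_image r (g : {perm T}) : {set T * T} :=
  [set (g p.1, g p.2) | p in r].

Definition Aut_cc S : {set {perm T}} :=
  [set g : {perm T} | [forall s in S, rel_image s g == s]].

Lemma Aut_cc_group_set S : group_set (Aut_cc S).
Proof.
apply/group_setP; split=> [|g h].
  rewrite inE; apply/forall_inP => s _; apply/eqP.
  rewrite -[RHS]imset_id; apply: eq_imset => -[x y] /=.
  by rewrite !perm1.
rewrite !inE => /forall_inP Hg /forall_inP Hh.
apply/forall_inP => s sS; apply/eqP.
rewrite -[RHS](eqP (Hh s sS)) -[in RHS](eqP (Hg s sS)) /rel_image -imset_comp.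
by apply: eq_imset => p /=; rewrite !permM.
Qed.

Canonical Aut_cc_group S := Group (Aut_cc_group_set S).

(* A permutation of D is represented, as in the library, by a permutation of  *)
(* T with support in D: Sym D is the group of these, and restr_perm D g is    *)
(* the restriction of g to D (for g leaving D invariant).                     *)
Definition quasitrivial S : Prop :=
  {in fibers S, forall D, restr_perm D @* Aut_cc S = Sym D}.

Definition fiber_sim S : rel {set T} :=
  fun D L => (D == L) || (#|rels_between S D L| == 2).

(* Maps between subsets of T are total functions on T whose values outside of *)
(* the domain are irrelevant.                                                 *)
Definition bij_between D L (f : T -> T) : Prop :=
  {in D &, injective f} /\ f @: D = L.

Definition graph_on D (f : T -> T) : {set T * T} := [set (x, f x) | x in D].

(* The inverse f @: D -> D of a map f that is injective on D.                 *)
Definition inv_on D (f : T -> T) (y : T) : T :=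
  odflt y [pick x in D | f x == y].

End CoherentConfigurations.

(* Main.v *)
(** Let n = #|D| and m = #|L| for fibers D, L, and let r be a relation of S
between D and L other than D x L. The family of the neighborhoods a r, a in D,
is invariant under Aut_cc S, which induces Sym L on L; hence it consists of all
subsets of L of some size 0 < k < m, so m <= 'C(m, k) <= n, and dually n <= m.
Thus 'C(m, k) = m, and choosing r with 2 k <= m forces k = 1: r is the graph of
a bijection D -> L. As Sym L is 2-transitive, the only other relation between
D and L is then the complement of that graph. Graphs of bijections in S compose
by coherence, so an automorphism is exactly a permutation that preserves the
fibers and commutes with the bijections f_ij; every choice of the g_i can be
realized, by gluing automorphisms that extend each of them separately. *)

Require Import Defs.
From mathcomp Require Import all_boot all_fingroup.

Set Implicit Arguments.
Unset Strict Implicit.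
Unset Printing Implicit Defensive.

Import GroupScope.

(** * Binomial bounds and families of sets closed under transpositions *)

Lemma leq_bin m k : 0 < k < m -> m <= 'C(m, k).
Proof.
elim: m k => // m IHm [//|k] /andP[_]; rewrite ltnS leq_eqVlt.
case/predU1P=> [<-|ltkm]; first by rewrite binSn.
rewrite binS -addn1; apply: leq_add; first exact: IHm.
by rewrite bin_gt0; do 2!apply: ltnW.
Qed.

(** If [k] is at least 2, Pascal's rule splits ['C(m, k)] into two terms. As [k.*2 <= m], both lower
    indices lie strictly between 0 and [m - 1], so each term is at least [m - 1], and [2 (m - 1)]
    exceeds [m] because [m] is at least 4. *)
Lemma bin_leq_eq1 m k : 0 < k -> k.*2 <= m -> 'C(m, k) <= m -> k = 1%N.
Proof.
case: m k => [|m] [|[|k]] // _; rewrite !doubleS ltnS => le2km.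
have lekm : k.+2 < m by apply: leq_trans le2km; rewrite !ltnS -addnn leq_addr.
rewrite binS leqNgt => /negP[]; apply: (@leq_trans (m + m)).
  by rewrite -add2n leq_add2r; apply: leq_trans lekm.
by rewrite leq_add // leq_bin //= ltnW.
Qed.

(** Transposing a point of [A :\: B] with a point of [B :\: A] makes [A :\: B] smaller, so finitely
    many transpositions of points of [L] turn [A] into [B]. *)
Lemma tperm_closed_card (T : finType) (L : {set T}) (P : {set T} -> Prop) :
    (forall x y A, x \in L -> y \in L -> P A -> P (tperm x y @: A)) ->
  forall A B : {set T}, A \subset L -> B \subset L -> #|A| = #|B| ->
  P A -> P B.
Proof.
move=> Pt A B; have [n] := ubnP #|A :\: B|.
elim: n A => // n IHn A leAn sAL sBL eqAB PA.
have [/eqP|/set0Pn[a aAB]] := eqVneq (A :\: B) set0.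
  rewrite setD_eq0 => sAB; suff <- : A = B by [].
  by apply/eqP; rewrite eqEcard sAB eqAB leqnn.
have [b bBA] : exists b, b \in B :\: A.
  apply/set0Pn; rewrite -card_gt0.
  have /eqP := eqAB; rewrite -(cardsID B A) -(cardsID A B) setIC eqn_add2l.
  by move=> /eqP <-; rewrite card_gt0; apply/set0Pn; exists a.
have [aB aA] := setDP aAB; have [bB bA] := setDP bBA.
have [aL bL] := (subsetP sAL _ aB, subsetP sBL _ bB).
apply: (IHn (tperm a b @: A)) => //; last exact: Pt.
- rewrite ltnS in leAn; apply: leq_trans leAn.
  rewrite (cardsD1 a (A :\: B)) aAB add1n ltnS subset_leq_card //.
  apply/subsetP=> _ /setDP[/imsetP[y yA ->]].
  case: tpermP => [_|eyb|/eqP nya nyb] yB; first by rewrite bB in yB.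
    by rewrite -eyb yA in bA.
  by rewrite !inE nya yA yB.
- apply/subsetP=> _ /imsetP[y yA ->].
  by case: tpermP => // _ _; apply: (subsetP sAL).
- by rewrite card_imset //; apply: perm_inj.
Qed.

(** * Relations and fibers of a coherent configuration *)

Section QuasitrivialConfiguration.

Variables (T : finType) (S : {set {set T * T}}).
Hypotheses (cohS : coherent S) (qtS : quasitrivial S).

Implicit Types (r s t : {set T * T}) (D L M : {set T}) (f h : T -> T).
Implicit Types (a b x y : T) (g : {perm T}).

Lemma rel_disjoint r s p : r \in S -> s \in S -> p \in r -> p \in s -> r = s.
Proof.
case: cohS => /and3P[_ tI _] _ _ _ rS sS pr ps.
by rewrite -(def_pblock tI rS pr) (def_pblock tI sS ps).
Qed.

Lemma rel_cover p : exists2 s, s \in S & p \in s.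
Proof.
case: cohS => /and3P[/eqP covS _ _] _ _ _.
by have: p \in cover S; [rewrite covS inE | case/bigcupP=> s sS ps; exists s].
Qed.

Lemma rel_neq0 s : s \in S -> exists p, p \in s.
Proof.
case: cohS => /and3P[_ _ S0] _ _ _ sS.
by apply/set0Pn; apply: contraNneq S0 => <-.
Qed.

Lemma converseS s : s \in S -> converse s \in S.
Proof. by case: cohS => _ _ convS _; apply: convS. Qed.

(* The intersection numbers matter only through their being zero or not. *)
Lemma coherentP r s t a b a' b' : r \in S -> s \in S -> t \in S ->
    (a, b) \in t -> (a', b') \in t ->
    (exists c, (a, c) \in r /\ (c, b) \in s) ->
  exists c, (a', c) \in r /\ (c, b') \in s.
Proof.
case: cohS => _ _ _ cohSc rS sS tS abt abt' [c [acr cbs]].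
suff /set0Pn[d] :
    neighbors a' r :&: neighbors b' (converse s) != set0.
  by rewrite !inE /= => /andP[adr dbs]; exists d.
rewrite -card_gt0 -(cohSc r s t rS sS tS a b a' b') // card_gt0.
by apply/set0Pn; exists c; rewrite !inE acr.
Qed.

Lemma in_diag x y D : ((x, y) \in diag D) = (x == y) && (x \in D).
Proof.
apply/imsetP/andP => [[z zD [-> ->]] | [/eqP <- xD]]; last by exists x.
by rewrite eqxx.
Qed.

Lemma fiber_cover x : exists2 D, D \in fibers S & x \in D.
Proof.
case: cohS => _ [E sES covE] _ _.
have: (x, x) \in cover E by rewrite covE in_diag eqxx inE.
(* The member [e] of [S] that contains [(x, x)] lies inside the diagonal, so it is the diagonal of
   its own projection, and that projection is the fiber of [x]. *)
case/bigcupP=> e eE xe; exists [set y | (y, y) \in e]; last by rewrite inE.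
rewrite inE; suff -> : diag [set y | (y, y) \in e] = e.
  exact: (subsetP sES).
apply/setP=> -[y z]; rewrite in_diag inE.
apply/andP/idP => [[/eqP <- //]|yze].
have: (y, z) \in cover E by apply/bigcupP; exists e.
by rewrite covE in_diag => /andP[/eqP eyz _]; rewrite -eyz in yze *.
Qed.

Lemma fiber_eq D L x : D \in fibers S -> L \in fibers S ->
  x \in D -> x \in L -> D = L.
Proof.
rewrite !inE => DS LS xD xL.
have eqDL : diag D = diag L.
  by apply: (rel_disjoint DS LS (p := (x, x))); rewrite in_diag eqxx.
by apply/setP=> y; have /setP/(_ (y, y)) := eqDL; rewrite !in_diag eqxx.
Qed.

(** The pair [(a, b)] factors through [diag D] followed by [s]; by coherence so does every pair of
    [s], which puts its first point in [D]. The second point is treated in the same way with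
    [diag L]. *)
Lemma rel_fibers s a b D L : D \in fibers S -> L \in fibers S -> s \in S ->
  (a, b) \in s -> a \in D -> b \in L -> s \subset setX D L.
Proof.
rewrite !inE => DS LS sS abs aD bL; apply/subsetP=> -[a' b'] abs'.
rewrite inE /=; apply/andP; split.
  have [|c [+ _]] := coherentP DS sS sS abs abs'.
    by exists a; rewrite in_diag eqxx.
  by rewrite in_diag => /andP[].
have [|c [_]] := coherentP sS LS sS abs abs'.
  by exists b; rewrite in_diag eqxx.
by rewrite in_diag => /andP[/eqP->].
Qed.

(** * Automorphisms and their action on a fiber *)

Lemma Aut_rel g s a b : g \in Aut_cc S -> s \in S ->
  ((g a, g b) \in s) = ((a, b) \in s).
Proof.
rewrite inE => /forall_inP gA sS; have /eqP eqs := gA s sS.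
rewrite -{1}eqs; apply/imsetP/idP => [[[c d] cds [/perm_inj-> /perm_inj->]]//|].
by exists (a, b).
Qed.

Lemma Aut_ccP g : {in S, forall s a b, (a, b) \in s -> (g a, g b) \in s} ->
  g \in Aut_cc S.
Proof.
move=> gS; rewrite inE; apply/forall_inP=> s sS.
rewrite eqEcard; apply/andP; split.
  by apply/subsetP=> _ /imsetP[[a b] abs ->]; apply: gS.
by rewrite card_imset // => -[a b] [c d] [/perm_inj-> /perm_inj->].
Qed.

Lemma Aut_fiber g D x : g \in Aut_cc S -> D \in fibers S ->
  (g x \in D) = (x \in D).
Proof.
move=> gA; rewrite inE => DS; have := Aut_rel x x gA DS.
by rewrite !in_diag !eqxx.
Qed.

Lemma invariant_astabs g D : {in D, forall x, g x \in D} -> g \in 'N(D | 'P).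
Proof. by move=> gD; rewrite !inE; apply/subsetP=> x /gD; rewrite inE. Qed.

Lemma Aut_astabs g D : g \in Aut_cc S -> D \in fibers S -> g \in 'N(D | 'P).
Proof. by move=> gA DS; apply: invariant_astabs => x; rewrite Aut_fiber. Qed.

(** The form in which quasitriviality is used from here on. *)
Lemma Aut_extends D (p : {perm T}) : D \in fibers S -> p \in Sym D ->
  exists2 g, g \in Aut_cc S & {in D, g =1 p}.
Proof.
move=> DS; rewrite -(qtS DS) => /morphimP[g gN gA ->].
by exists g => // x xD; rewrite restr_permE.
Qed.

Lemma tperm_Sym D x y : x \in D -> y \in D -> tperm x y \in Sym D.
Proof.
move=> xD yD; rewrite inE; apply/subsetP=> z; rewrite inE.
by case: tpermP => [->|->|]; rewrite ?eqxx.
Qed.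

Lemma Aut_trans D x y : D \in fibers S -> x \in D -> y \in D ->
  exists2 g, g \in Aut_cc S & g x = y.
Proof.
move=> DS xD yD; have [g gA eg] := Aut_extends DS (tperm_Sym xD yD).
by exists g; rewrite // eg // tpermL.
Qed.

(** Once [x] has been moved to [x'], the image of [y] is swapped with [y']; this swap fixes [x'],
    which differs from both. *)
Lemma Aut_trans2 D x y x' y' : D \in fibers S ->
    x \in D -> y \in D -> x' \in D -> y' \in D -> x != y -> x' != y' ->
  exists2 g, g \in Aut_cc S & g x = x' /\ g y = y'.
Proof.
move=> DS xD yD xD' yD' nxy nxy'; have [g gA gx] := Aut_trans DS xD xD'.
have gyD : g y \in D by rewrite Aut_fiber.
have [h hA eh] := Aut_extends DS (tperm_Sym gyD yD').
exists (g * h); first exact: groupM.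
rewrite !permM gx !eh // tpermL; split=> //.
by rewrite tpermD // eq_sym // -gx (inj_eq perm_inj).
Qed.

(** * Neighborhoods of points and their sizes *)

Lemma neighbors_Aut g r a : g \in Aut_cc S -> r \in S ->
  neighbors (g a) r = g @: neighbors a r.
Proof.
move=> gA rS; apply/setP=> b; rewrite inE.
apply/idP/imsetP => [abr|[c car ->]]; last by rewrite Aut_rel // inE in car *.
by exists (g^-1 b); rewrite ?permKV // inE -(Aut_rel _ _ gA) // permKV.
Qed.

Lemma card_neighbors D r a b : D \in fibers S -> r \in S ->
  a \in D -> b \in D -> #|neighbors a r| = #|neighbors b r|.
Proof.
move=> DS rS aD bD; have [g gA <-] := Aut_trans DS aD bD.
by rewrite neighbors_Aut // card_imset //; apply: perm_inj.
Qed.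

Lemma neighbors_sub D L r a : r \subset setX D L -> neighbors a r \subset L.
Proof.
by move=> sr; apply/subsetP=> b; rewrite inE => /(subsetP sr); case/setXP.
Qed.

(** Transpositions of points of [L] extend to automorphisms, which permute the neighborhoods; hence
    [tperm_closed_card] applies to the family of all neighborhoods. *)
Lemma neighbors_onto D L r a (B : {set T}) :
    D \in fibers S -> L \in fibers S -> r \in S -> r \subset setX D L ->
    a \in D -> B \subset L -> #|neighbors a r| = #|B| ->
  exists2 b, b \in D & B = neighbors b r.
Proof.
move=> DS LS rS sr aD sBL eqB.
pose P A := exists2 b, b \in D & A = neighbors b r.
apply: (@tperm_closed_card _ L P _ (neighbors a r)) => //; last by exists a.
  move=> x y _ xL yL [b bD ->].
  have [g gA eg] := Aut_extends LS (tperm_Sym xL yL).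
  exists (g b); rewrite ?Aut_fiber // neighbors_Aut //.
  by apply: eq_in_imset => z /(subsetP (neighbors_sub b sr)) zL; rewrite -eg.
exact: neighbors_sub sr.
Qed.

(** The binomial bound counts the subsets of [L] of the given size: each is a neighborhood of some
    point of [D]. The strict bounds need only one suitable point of [D], since by transitivity all
    neighborhoods have the same size. *)
Lemma neighbors_bin D L r a :
    D \in fibers S -> L \in fibers S -> r \in S -> r \subset setX D L ->
    r != setX D L -> a \in D ->
  0 < #|neighbors a r| < #|L| /\ 'C(#|L|, #|neighbors a r|) <= #|D|.
Proof.
move=> DS LS rS sr nr aD; split; last first.
  rewrite -cards_draws; apply: leq_trans _ (leq_imset_card (fun x => neighbors x r) D).
  apply/subset_leq_card/subsetP => B; rewrite inE => /andP[sBL /eqP eqB].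
  have [|b bD ->] := neighbors_onto DS LS rS sr aD sBL; first by rewrite eqB.
  exact: imset_f.
apply/andP; split.
  have [[b c] bcr] := rel_neq0 rS; have /setXP[bD _] := subsetP sr _ bcr.
  rewrite (card_neighbors DS rS aD bD) card_gt0.
  by apply/set0Pn; exists c; rewrite inE.
have [[b c]] : exists p, p \in setX D L :\: r.
  by apply/set0Pn; rewrite setD_eq0; apply: contra nr => sr'; rewrite eqEsubset sr.
case/setDP=> /setXP[bD cL] bcr; rewrite (card_neighbors DS rS aD bD).
apply: proper_card; rewrite properE (neighbors_sub _ sr) /=.
by apply/subsetPn; exists c; rewrite // inE.
Qed.

Lemma sub_converse D L r : r \subset setX D L -> converse r \subset setX L D.
Proof.
by move=> sr; apply/subsetP=> -[a b]; rewrite inE => /(subsetP sr); rewrite !inE andbC.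
Qed.

Lemma converseK r : converse (converse r) = r.
Proof. by apply/setP=> -[a b]; rewrite !inE. Qed.

Lemma converse_setX D L : converse (setX D L) = setX L D.
Proof. by apply/setP=> -[a b]; rewrite !inE andbC. Qed.

(** * Relations that are graphs of bijections between fibers *)

Definition matching D L f := bij_between D L f /\ graph_on D f \in S.

Lemma in_graph D f a b : ((a, b) \in graph_on D f) = (a \in D) && (b == f a).
Proof.
by apply/imsetP/andP => [[x xD [-> ->]]|[aD /eqP->]]; [rewrite xD | exists a].
Qed.

Lemma bij_between_mem D L f a : bij_between D L f -> a \in D -> f a \in L.
Proof. by case=> _ <- aD; apply: imset_f. Qed.

Lemma matching_ex D L s : D \in fibers S -> L \in fibers S -> s \in S ->
  s \subset setX D L -> s != setX D L -> 1 < #|D| /\ exists f, matching D L f.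
Proof.
move=> DS LS sS ssub snf.
have [[a b]] : exists p, p \in setX D L :\: s.
  by apply/set0Pn; rewrite setD_eq0; apply: contra snf => ?; rewrite eqEsubset ssub.
case/setDP=> /setXP[aD bL] abs.
(* Either [s] or the relation [t] through the missing pair [(a, b)] will do: the neighborhoods of
   [a] in [s] and in [t] are disjoint subsets of [L], so one of them fills at most half of [L]. *)
have [r [rS rsub rnf rle]] : exists r,
    [/\ r \in S, r \subset setX D L, r != setX D L & #|neighbors a r|.*2 <= #|L|].
  have [les|les] := leqP #|neighbors a s|.*2 #|L|; first by exists s.
  have [t tS abt] := rel_cover (a, b).
  have tsub := rel_fibers DS LS tS abt aD bL.
  have tds p : p \in t -> p \in s -> False.
    by move=> pt ps; rewrite (rel_disjoint sS tS ps pt) abt in abs.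
  exists t; split=> //.
    apply/eqP=> tf; have [p ps] := rel_neq0 sS.
    by apply: (tds p) => //; rewrite tf (subsetP ssub).
  have: #|neighbors a s| + #|neighbors a t| <= #|L|.
    rewrite -cardsUI (_ : _ :&: _ = set0) ?cards0 ?addn0.
      by apply: subset_leq_card; rewrite subUset !(@neighbors_sub D).
    by apply/setP=> c; rewrite !inE; apply/andP=> -[cs ct]; apply: tds ct cs.
  move=> leL; rewrite -addnn; apply: leq_trans (leL).
  rewrite leq_add2r leqNgt; apply/negP => ltst.
  have := leq_ltn_trans leL les; rewrite -addnn ltn_add2l.
  by rewrite ltnNge ltnW.
(* The counts for [r] and for its converse bound [#|L|] and [#|D|] by each other. With equality,
   ['C(#|L|, k) <= #|L|] forces neighborhoods of size [k = 1]. *)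
have [/andP[k0 kL] leCD] := neighbors_bin DS LS rS rsub rnf aD.
have leLD : #|L| <= #|D| by apply: leq_trans leCD; rewrite leq_bin ?k0.
have [|/andP[l0 lD] leCL] :=
    neighbors_bin LS DS (converseS rS) (sub_converse rsub) _ bL.
  by apply: contra rnf => /eqP er; rewrite -(converseK r) er converse_setX.
have leDL : #|D| <= #|L| by apply: leq_trans leCL; rewrite leq_bin ?l0.
have eqDL : #|D| = #|L| by apply/eqP; rewrite eqn_leq leDL.
have k1 : #|neighbors a r| = 1%N.
  by apply: bin_leq_eq1 rle _ => //; rewrite -{2}eqDL.
split; first exact: leq_ltn_trans l0 lD.
(* The default is never taken on [D], where each neighborhood is a singleton. *)
pose f x := odflt x [pick y | (x, y) \in r].
have fE x : x \in D -> neighbors x r = [set f x].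
  move=> xD; have /eqP/cards1P[y ey] : #|neighbors x r| = 1%N.
    by rewrite -k1 (card_neighbors DS rS xD aD).
  have rE z : ((x, z) \in r) = (z == y) by rewrite -in_set1 -ey inE.
  rewrite ey /f; case: pickP => [z|/(_ y)]; rewrite rE ?eqxx //.
  by move=> /eqP->.
have fD : f @: D = L.
  apply/eqP; rewrite eqEsubset; apply/andP; split.
    apply/subsetP=> _ /imsetP[x xD ->]; apply: (subsetP (neighbors_sub x rsub)).
    by rewrite fE ?set11.
  (* Each singleton of [L] has the size of a neighborhood, hence is one. Injectivity of [f] then
     follows from [#|D| = #|L|]. *)
  apply/subsetP=> y yL.
  have [||x xD /setP/(_ y)] := neighbors_onto (B := [set y]) DS LS rS rsub aD.
  - by rewrite sub1set.
  - by rewrite k1 cards1.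
  by rewrite fE // !inE eqxx => /esym/eqP->; apply: imset_f.
exists f; split; first by split=> //; apply/imset_injP; rewrite fD eqDL.
suff -> : graph_on D f = r by [].
apply/setP=> -[x y]; rewrite in_graph.
apply/andP/idP => [[xD /eqP->]|xyr].
  by have /setP/(_ (f x)) := fE x xD; rewrite !inE eqxx => ->.
have /setXP[xD _] := subsetP rsub _ xyr.
by have /setP/(_ y) := fE x xD; rewrite !inE xyr => <-.
Qed.

(** The pair [(a, f a)] lies in the graph, hence so does its image under [g]. *)
Lemma matching_Aut D L f g a : matching D L f -> D \in fibers S ->
  g \in Aut_cc S -> a \in D -> f (g a) = g (f a).
Proof.
case=> _ fS DS gA aD; have := Aut_rel a (f a) gA fS.
by rewrite !in_graph Aut_fiber // aD eqxx /= => /eqP.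
Qed.

Lemma matching_sub D L f : bij_between D L f -> graph_on D f \subset setX D L.
Proof.
move=> fb; apply/subsetP=> -[a b]; rewrite in_graph inE /= => /andP[aD /eqP->].
by rewrite aD (bij_between_mem fb).
Qed.

(** A relation other than the graph avoids it. By 2-transitivity on [L], an automorphism takes
    [(f a, b)] to [(f a', b')]; commuting with [f], it takes [a] to [a'], so a single pair off the
    graph in [s] yields all the others. *)
Lemma matching_rels D L f s : D \in fibers S -> L \in fibers S ->
    matching D L f -> s \in S -> s \subset setX D L ->
  s = graph_on D f \/ s = setX D L :\: graph_on D f.
Proof.
move=> DS LS mf sS ssub; have [fb fS] := mf.
have [->|nsf] := eqVneq s (graph_on D f); [by left | right].
have sdf p : p \in s -> p \in graph_on D f -> False.
  by move=> ps pf; rewrite (rel_disjoint sS fS ps pf) eqxx in nsf.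
apply/setP=> p; apply/idP/setDP => [ps|[]].
  by split; [apply: (subsetP ssub) | apply/negP=> /(sdf p ps)].
case: p => a' b' /setXP[aD' bL']; rewrite in_graph aD' /= eq_sym => nab'.
have [[a b] abs] := rel_neq0 sS; have /setXP[aD bL] := subsetP ssub _ abs.
have nab : f a != b.
  by apply/eqP=> eb; apply: sdf abs _; rewrite in_graph aD eb /=.
have [g gA [ga gb]] := Aut_trans2 LS (bij_between_mem fb aD) bL
  (bij_between_mem fb aD') bL' nab nab'.
suff <- : g a = a' by rewrite -gb Aut_rel.
by case: fb => fI _; apply: fI; rewrite ?Aut_fiber // (matching_Aut mf).
Qed.

Lemma inv_onK D f : {in D &, injective f} -> {in D, cancel f (inv_on D f)}.
Proof.
move=> fI x xD; rewrite /inv_on; case: pickP => [y /andP[yD /eqP /fI->]//|].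
by move/(_ x); rewrite xD eqxx.
Qed.

(** Let [t] be the relation through [(f a, h a)]. Transitivity on [D] puts all pairs [(f x, h x)] in
    [t]; coherence, applied to the converse of the first graph followed by the second, shows that
    [t] has no other pair. *)
Lemma matching_comp D L M f h : D \in fibers S -> L \in fibers S ->
    matching D L f -> matching D M h -> matching L M (h \o inv_on D f).
Proof.
move=> DS LS mf mh; have [[fI fD] fS] := mf; have [[hI hD] hS] := mh.
have fK := inv_onK fI.
have surj y : y \in L -> exists2 x, x \in D & y = f x.
  by rewrite -fD => /imsetP.
split.
  split=> [_ _ /surj[x xD ->] /surj[y yD ->]|].
    by rewrite /= !fK // => /hI->.
  rewrite -fD -hD -imset_comp; apply: eq_in_imset => x xD.
  by rewrite /= fK.
have [[a b]] := rel_neq0 fS; rewrite in_graph => /andP[aD _].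
have [t tS fht] := rel_cover (f a, h a).
suff -> : graph_on L (h \o inv_on D f) = t by [].
apply/setP=> -[y z]; rewrite in_graph; apply/andP/idP => [[/surj[x xD ->]]|yzt].
  rewrite /= fK // => /eqP->; have [g gA <-] := Aut_trans DS aD xD.
  by rewrite (matching_Aut mf) ?(matching_Aut mh) ?Aut_rel.
have [|x []] := coherentP (converseS fS) hS tS fht yzt.
  by exists a; rewrite inE !in_graph aD !eqxx.
rewrite inE !in_graph /= => /andP[xD /eqP->] /andP[_ /eqP->].
by rewrite fK // -fD imset_f.
Qed.

Lemma matching_id D : D \in fibers S -> matching D D id.
Proof. by rewrite inE => DS; split; first by split=> //; rewrite imset_id. Qed.

Lemma matching_card D L f : matching D L f -> #|L| = #|D|.
Proof. by case=> -[fI <-] _; rewrite card_in_imset. Qed.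

(** * The equivalence of fibers *)

(** The bound [1 < #|D|] makes the complement of the graph nonempty: between two singletons the
    graph is all of [setX D L], and there is only one relation. *)
Lemma fiber_simP D L : D \in fibers S -> L \in fibers S ->
  reflect (D = L \/ 1 < #|D| /\ exists f, matching D L f) (fiber_sim S D L).
Proof.
move=> DS LS; apply: (iffP orP) => [[/eqP->|/eqP eq2]|[->|[D1 [f mf]]]].
- by left.
- right; suff [s sS snf] : exists2 s, s \in rels_between S D L & s != setX D L.
    by move: sS; rewrite inE => /andP[sS ssub]; apply: matching_ex ssub snf.
  have /subsetPn[s sS] : ~~ (rels_between S D L \subset [set setX D L]).
    by apply/negP=> /subset_leq_card; rewrite eq2 cards1.
  by rewrite inE => snf; exists s.
- by left.
right; have [fb fS] := mf; have fsub := matching_sub fb.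
have /card_gt1P[a [b [aD bD nab]]] := D1; have fbL := bij_between_mem fb bD.
have [t tS abt] := rel_cover (a, f b).
have tsub := rel_fibers DS LS tS abt aD fbL.
have et : t = setX D L :\: graph_on D f.
  have [et|//] := matching_rels DS LS mf tS tsub.
  move: abt; rewrite et in_graph => /andP[_ /eqP]; case: fb => fI _.
  by move/fI=> eab; rewrite eab // eqxx in nab.
have -> : rels_between S D L = [set graph_on D f; t].
  apply/setP=> s; rewrite !inE; apply/andP/orP => [[sS ssub]|[]/eqP->] //.
  by have [->|->] := matching_rels DS LS mf sS ssub; rewrite et eqxx; auto.
rewrite cards2; case: (graph_on D f =P t) => // ef.
by have := abt; rewrite {1}et => /setDP[_]; rewrite ef abt.
Qed.

Lemma fiber_sim_equiv : {in fibers S & &, equivalence_rel (fiber_sim S)}.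
Proof.
have symP D L : D \in fibers S -> L \in fibers S ->
    fiber_sim S D L -> fiber_sim S L D.
  move=> DS LS /fiber_simP-/(_ DS LS)[->|[D1 [f mf]]]; first by rewrite /fiber_sim eqxx.
  apply/fiber_simP => //; right; rewrite (matching_card mf); split=> //.
  (* The inverse matching is the composite of the inverse of [f] with the identity matching of
     [D]. *)
  by exists (id \o inv_on D f); apply: matching_comp (matching_id DS).
have trP D L M : D \in fibers S -> L \in fibers S -> M \in fibers S ->
    fiber_sim S D L -> fiber_sim S D M -> fiber_sim S L M.
  move=> DS LS MS DL DM.
  have [<-//|[D1 [f mf]]] := fiber_simP DS LS DL.
  have [<-|[_ [h mh]]] := fiber_simP DS MS DM; first exact: symP.
  apply/fiber_simP => //; right; rewrite (matching_card mf); split=> //.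
  by exists (h \o inv_on D f); apply: matching_comp mh.
move=> D L M DS LS MS; split=> [|DL]; first by rewrite /fiber_sim eqxx.
by apply/idP/idP; apply: trP => //; apply: symP.
Qed.

(** * The automorphism group in terms of labelled fibers, with [F j] matching the first fiber of a
    class to its [j]-th one *)

Section LabelledFibers.

Variables (m : nat) (k : 'I_m -> nat) (Delta : forall i, 'I_(k i).+1 -> {set T}).
Variable (F : forall i, 'I_(k i).+1 -> T -> T).
Hypothesis Delta_fiber : forall i j, @Delta i j \in fibers S.
Hypothesis Delta_cover :
  forall D, D \in fibers S -> exists i (j : 'I_(k i).+1), D = Delta j.
Hypothesis Delta_sim : forall i j i' j',
  fiber_sim S (@Delta i j) (@Delta i' j') = (i == i').
Hypothesis F_matching : forall i (j : 'I_(k i).+1),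
  matching (@Delta i ord0) (Delta j) (F j).
Hypothesis F0 : forall i, @F i ord0 = id.

Let F_onto i (j : 'I_(k i).+1) y : y \in Delta j ->
  exists2 x, x \in @Delta i ord0 & y = F j x.
Proof. by have [[_ <-] _] := F_matching j; move=> /imsetP. Qed.

(** Conversely, a relation between fibers that is not their full product joins fibers of one class.
    It is then the graph of [F j'] after the inverse of [F j], or the complement of that graph, and
    [g] commutes with both maps. *)
Lemma Aut_cc_commutes g : g \in Aut_cc S <->
  (forall i (j : 'I_(k i).+1), {in Delta j, forall x, g x \in Delta j}) /\
  (forall i (j : 'I_(k i).+1),
     {in @Delta i ord0, forall x, g (F j x) = F j (g x)}).
Proof.
split=> [gA|[gD gF]].
  split=> i j x xD; first by rewrite Aut_fiber.
  by rewrite (matching_Aut (F_matching j)).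
apply: Aut_ccP => s sS a b abs.
have [D DS aD] := fiber_cover a; have [L LS bL] := fiber_cover b.
have ssub := rel_fibers DS LS sS abs aD bL.
have [i [j eD]] := Delta_cover DS; have [i' [j' eL]] := Delta_cover LS.
subst D L.
have [eqs|nf] := eqVneq s (setX (Delta j) (Delta j')).
  by rewrite eqs !inE !gD.
have eii : i = i'.
  apply/eqP; rewrite -(Delta_sim j j'); apply/fiber_simP => //; right.
  exact: matching_ex ssub nf.
subst i'; have mf := matching_comp (Delta_fiber ord0) (Delta_fiber j)
  (F_matching j) (F_matching j').
have [[fI _] _] := F_matching j; have [[hI _] _] := F_matching j'.
(* An equivalence rather than an implication, so that it serves the graph and its complement
   alike. *)
have fg u v : u \in Delta j -> v \in Delta j' ->
  ((u, v) \in graph_on (Delta j) (F j' \o inv_on (@Delta i ord0) (F j))) =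
  ((g u, g v) \in graph_on (Delta j) (F j' \o inv_on (@Delta i ord0) (F j))).
  move=> uD; rewrite !in_graph uD gD //=.
  have [x xD ->] := F_onto uD; move/F_onto=> [y yD ->].
  rewrite !gF // !inv_onK ?gD //.
  by apply/eqP/eqP => [/hI->|/hI/perm_inj->] //; apply: gD.
have [es|es] := matching_rels (Delta_fiber j) (Delta_fiber j') mf sS ssub.
  by rewrite es -fg // -es.
by move: abs; rewrite es !in_setD -fg // => /andP[-> _]; rewrite inE /= !gD.
Qed.

Let label x : exists i, exists j : 'I_(k i).+1, x \in Delta j.
Proof.
by have [D /Delta_cover[i [j ->]] xD] := fiber_cover x; exists i, j.
Qed.

Let label_uniq i (j : 'I_(k i).+1) i' (j' : 'I_(k i').+1) x :
  x \in Delta j -> x \in Delta j' -> i = i'.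
Proof.
move=> xj xj'; apply/eqP; rewrite -(Delta_sim j j').
by rewrite (fiber_eq (Delta_fiber j) (Delta_fiber j') xj xj') /fiber_sim eqxx.
Qed.

(** Each [y i] extends to an automorphism [h i]; the glued map follows [h i] on all fibers of class
    [i]. The commutation criterion involves one class at a time, so the result is again an
    automorphism. *)
Lemma Aut_cc_glue (y : 'I_m -> {perm T}) :
    (forall i, y i \in Sym (@Delta i ord0)) ->
  exists2 g, g \in Aut_cc S & forall i, {in @Delta i ord0, g =1 y i}.
Proof.
move=> ySym.
have [h hA hy] := fin_all_exists2
  (fun i => Aut_extends (Delta_fiber (ord0 : 'I_(k i).+1)) (ySym i)).
have [c cP] := fin_all_exists label.
have hD i (j : 'I_(k i).+1) l x : (h l x \in Delta j) = (x \in Delta j).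
  by rewrite Aut_fiber.
have cE i (j : 'I_(k i).+1) x : x \in Delta j -> c x = i.
  by have [j' xj'] := cP x; apply: label_uniq xj'.
(* Every [h l] preserves the fibers, so points with equal images lie in the same class and are moved
   by the same permutation. *)
have gI : injective (fun x => h (c x) x).
  move=> x x' /= exx'; have [j xj] := cP x.
  have := xj; rewrite -(hD _ _ (c x)) exx' hD => /cE ecx.
  by move: exx'; rewrite ecx => /perm_inj.
exists (perm gI); last by move=> i x xD; rewrite permE (cE _ _ _ xD) hy.
apply/Aut_cc_commutes; split=> i j x xD; rewrite !permE; first by rewrite hD.
have FD : F j x \in Delta j.
  by have [fb _] := F_matching j; apply: bij_between_mem fb xD.
by rewrite (cE _ _ _ xD) (cE _ _ _ FD) (matching_Aut (F_matching j)).
Qed.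

(** The isomorphism restricts an automorphism to the first fiber of each class. It is injective
    because the [F j] carry these restrictions to all other fibers, and surjective by gluing. *)
Lemma Aut_cc_isog : Aut_cc S \isog setXn (fun i => Sym (@Delta i ord0)).
Proof.
pose phi g : {dffun forall i : 'I_m, {perm T}} :=
  [ffun i => restr_perm (@Delta i ord0) g].
have phiM : {in Aut_cc_group S &, {morph phi : g h / g * h}}.
  move=> g h gA hA; apply/ffunP=> i; rewrite !ffunE /=.
  by apply: morphM; apply: Aut_astabs.
apply: (isom_isog (Morphism phiM) (subxx _)); apply/isomP; split.
  apply/injmP => g h gA hA egh; apply/permP=> y.
  have [i [j yD]] := label y; have [x xD ->] := F_onto yD.
  rewrite -!(matching_Aut (F_matching j)) //; congr (F j _).
  have /ffunP/(_ i) := egh; rewrite !ffunE => /permP/(_ x).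
  by rewrite !restr_permE //; apply: Aut_astabs.
apply/eqP; rewrite eqEsubset; apply/andP; split; apply/subsetP=> y.
  by case/morphimP=> g _ gA ->; apply/setXnP => i; rewrite ffunE inE restr_perm_on.
move/setXnP=> ySym; apply/morphimP.
have [g gA gy] := Aut_cc_glue ySym; exists g => //; apply/ffunP=> i.
rewrite ffunE; apply/permP=> x; have := ySym i; rewrite inE => yS.
have [xD|xD] := boolP (x \in Delta (ord0 : 'I_(k i).+1)).
  by rewrite restr_permE // ?(gy i) //; apply: Aut_astabs.
by rewrite (out_perm yS) // (out_perm (restr_perm_on _ _)).
Qed.

(** The commutation criterion in conjugated form, obtained by writing a point of [Delta j] as
    [F j y]; for [j = ord0] commutation is trivial, as [F ord0] is the identity. *)
Lemma Aut_cc_restr g : g \in Aut_cc S <->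
  {in fibers S, forall D, [set g x | x in D] = D} /\
  (forall i, exists2 gi, gi \in Sym (@Delta i ord0)
     & restr_perm (@Delta i ord0) g = gi /\
       forall j : 'I_(k i).+1, j != ord0 -> {in Delta j, forall x,
         restr_perm (Delta j) g x = F j (gi (inv_on (@Delta i ord0) (F j) x))}).
Proof.
split=> [gA | [gD gR]].
  split=> [D DS|i].
    apply/eqP; rewrite eqEcard card_imset ?leqnn ?andbT; last exact: perm_inj.
    by apply/subsetP=> _ /imsetP[x xD ->]; rewrite Aut_fiber.
  exists (restr_perm (@Delta i ord0) g); first by rewrite inE restr_perm_on.
  split=> // j _ x xj; have [[fI _] _] := F_matching j.
  rewrite restr_permE ?(Aut_astabs gA) //.
  have [y yD ->] := F_onto xj; rewrite inv_onK // restr_permE ?(Aut_astabs gA) //.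
  by rewrite (matching_Aut (F_matching j)).
have {}gD i (j : 'I_(k i).+1) : {in Delta j, forall x, g x \in Delta j}.
  by move=> x xD; rewrite -[in X in _ \in X](gD _ (Delta_fiber j)) imset_f.
apply/Aut_cc_commutes; split=> // i j x xD.
have [->|nj0] := eqVneq j ord0; first by rewrite !F0.
have [[fI _] _] := F_matching j.
have FD : F j x \in Delta j.
  by have [fb _] := F_matching j; apply: bij_between_mem fb xD.
have [gi _ [egi /(_ j nj0 _ FD)]] := gR i.
rewrite inv_onK // -egi !restr_permE //; apply: invariant_astabs; exact: gD.
Qed.

End LabelledFibers.

End QuasitrivialConfiguration.

(** * From the classes of fibers and the chosen bijections to the labelled setting *)

Theorem theorem3p2 (T : finType) (S : {set {set T * T}})
    (cohS : coherent S) (qtS : quasitrivial S) :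
  {in fibers S & &, equivalence_rel (fiber_sim S)} /\
  (* Phi i, for i < m, are the classes; Delta i j, for j <= k i, are the
     members of Phi i, so that Delta i ord0 is the first one *)
  forall (m : nat) (Phi : 'I_m -> {set {set T}})
    (k : 'I_m -> nat) (Delta : forall i : 'I_m, 'I_(k i).+1 -> {set T}),
    injective Phi ->
    [set Phi i | i : 'I_m] = equivalence_partition (fiber_sim S) (fibers S) ->
    (forall i, injective (Delta i)) ->
    (forall i, [set Delta i j | j : 'I_(k i).+1] = Phi i) ->
    (forall (i : 'I_m) (j : 'I_(k i).+1), j != ord0 ->
       exists2 f : T -> T, bij_between (Delta i ord0) (Delta i j) f
         & graph_on (Delta i ord0) f
             \in rels_between S (Delta i ord0) (Delta i j)) /\
    forall f : forall i : 'I_m, 'I_(k i).+1 -> T -> T,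
      (forall (i : 'I_m) (j : 'I_(k i).+1), j != ord0 ->
         bij_between (Delta i ord0) (Delta i j) (f i j) /\
         graph_on (Delta i ord0) (f i j)
           \in rels_between S (Delta i ord0) (Delta i j)) ->
      Aut_cc S \isog setXn (fun i : 'I_m => Sym (Delta i ord0)) /\
      forall g : {perm T},
        g \in Aut_cc S <->
        {in fibers S, forall D : {set T}, [set g x | x in D] = D} /\
        (forall i : 'I_m,
           exists2 gi : {perm T}, gi \in Sym (Delta i ord0)
             & restr_perm (Delta i ord0) g = gi /\
               forall j : 'I_(k i).+1, j != ord0 ->
                 {in Delta i j, forall x,
                    restr_perm (Delta i j) g x =
                    f i j (gi (inv_on (Delta i ord0) (f i j) x))}).
Proof.
have simR := fiber_sim_equiv cohS qtS; split=> // m Phi k Delta PhiI PhiE DeltaI DeltaE.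
have /and3P[/eqP covP tiP _] := equivalence_partitionP simR.
rewrite -PhiE in covP tiP.
have PhiP i : Phi i \in [set Phi i | i : 'I_m] by apply: imset_f.
have DPhi i j : Delta i j \in Phi i by rewrite -DeltaE imset_f.
have Dfib i j : Delta i j \in fibers S.
  by rewrite -covP; apply/bigcupP; exists (Phi i); [apply: PhiP | apply: DPhi].
have Dcov D : D \in fibers S -> exists i j, D = Delta i j.
  rewrite -covP => /bigcupP[_ /imsetP[i _ ->]]; rewrite -DeltaE.
  by case/imsetP=> j _ ->; exists i, j.
have Dsim i j i' j' : fiber_sim S (Delta i j) (Delta i' j') = (i == i').
  (* Similar fibers lie in the same block of the partition; the blocks are the [Phi i], and [Phi] is
     injective. *)
  rewrite -(pblock_equivalence_partition simR) ?Dfib // -PhiE.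
  rewrite (def_pblock tiP (PhiP i) (DPhi i j)).
  apply/idP/eqP => [Di'|->] //; apply: PhiI.
  rewrite -(def_pblock tiP (PhiP i) Di').
  exact: def_pblock tiP (PhiP i') (DPhi i' j').
split=> [i j nj0 | f fP].
  have /(fiber_simP cohS qtS (Dfib _ _) (Dfib _ _)) : fiber_sim S (Delta i ord0) (Delta i j).
    by rewrite Dsim.
  case=> [/DeltaI ej|[_ [h [hb hS]]]]; first by rewrite ej eqxx in nj0.
  by exists h; rewrite // inE hS matching_sub.
(* The map [f i ord0] is arbitrary; putting the identity in its place gives a matching for every
   [j]. *)
pose F i (j : 'I_(k i).+1) := if j == ord0 then id else f i j.
have FM i j : matching S (Delta i ord0) (Delta i j) (F i j).
  rewrite /F; case: eqVneq => [->|nj0]; first exact: matching_id.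
  by have [fb] := fP i j nj0; rewrite inE => /andP[].
split=> [|g]; first exact: Aut_cc_isog FM.
have F0 i : F i ord0 = id by rewrite /F eqxx.
apply: iff_trans (Aut_cc_restr cohS qtS Dfib Dcov Dsim FM F0 g) _.
split=> -[gD gR]; split=> // i; have [gi giS [egi gf]] := gR i;
  by exists gi => //; split=> // j nj0 x xj; rewrite gf // /F (negPf nj0).
Qed.
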